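(* For every integer $n \ge 3$, $|\zeta(n) - r(n)| < 1.985$, where, with $N := \lfloor \log_2 \log_5 n \rfloor + 1$, \[ r(n) := \left(\sum_{j=1}^N \frac{1}{2^{j-1}} n^{\frac{1}{2^j}}\right) - \frac{2^{N-1} - 1}{2^{N-1}}. \]
   Context: A reachable pair of a digraph is an ordered pair $(\alpha,\beta)$ of (not necessarily distinct) vertices with a directed path (possibly of length $0$) from $\alpha$ to $\beta$; the weight of a digraph is its number of reachable pairs. $W(n)$ is the set of weights of digraphs on $n$ vertices, and $b(n)$ is the largest integer such that every integer $k$ with $n\le k\le b(n)$ lies in $W(n)$. Define $\ell(z) := b(z)-z+3$. For an integer $n\ge 3$, $\zeta(n)$ is the unique positive integer such that $\ell(\zeta(n)) \le n < \ell(\zeta(n)+1)$. *)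

(* Defs.v *)
From mathcomp Require Import all_boot all_order all_algebra.
From mathcomp Require Import all_classical all_reals all_analysis.
From mathcomp Require Import zify.

Set Implicit Arguments.
Unset Strict Implicit.
Unset Printing Implicit Defensive.

Import Order.TTheory GRing.Theory Num.Theory.

Local Open Scope classical_set_scope.
Local Open Scope ring_scope.

(* A digraph on T is an edge relation; loops are allowed, which does not affect
   reachability.  [connect] includes paths of length 0. *)
Definition weight (T : finType) (e : rel T) : nat :=
  #|[set p : T * T | connect e p.1 p.2]%SET|.

Definition weights (n : nat) : set nat :=
  [set k | exists e : rel 'I_n, weight e = k].

Definition weights_upto (n m : nat) : bool :=
  `[< forall k : nat, (n <= k <= m)%N -> weights n k >].

Section Weights.
Local Open Scope nat_scope.

Lemma weightE n (e : rel 'I_n) :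
  weight e = \sum_(i < n) \sum_(j < n) connect e i j.
Proof.
rewrite /weight -sum1_card big_mkcond pair_big /=.
by apply: eq_bigr => -[x y] _; rewrite inE /=; case: connect.
Qed.

Lemma weight_ge n (e : rel 'I_n) : n <= weight e.
Proof.
rewrite weightE -[X in X <= _]card_ord -sum1_card; apply: leq_sum => x _.
by rewrite (bigD1 x) //= connect0.
Qed.

Lemma weight_le n (e : rel 'I_n) : weight e <= n ^ 2.
Proof. by rewrite (leq_trans (max_card _)) // card_prod card_ord. Qed.

Lemma ex_weights_upto n : exists m, weights_upto n m.
Proof.
exists n; apply/asboolP => k /andP[nk kn].
have -> : k = n by lia.
exists (fun _ _ => false); rewrite weightE -[RHS]card_ord -[RHS]sum1_card.
apply: eq_bigr => x _; rewrite (bigD1 x) //= connect0 big1 // => y yx.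
case: connectP => // -[[|z p] //= _ E]; by rewrite E eqxx in yx.
Qed.

Lemma weights_upto_le n m : weights_upto n m -> m <= n ^ 2.
Proof.
move=> /asboolP H; case: (leqP n m) => nm.
  by have [|e <-] := H m; [lia | exact: weight_le].
by rewrite (leq_trans (ltnW nm)) // expnS expn1; nia.
Qed.

End Weights.

Definition b (n : nat) : nat := ex_maxn (ex_weights_upto n) (@weights_upto_le n).

Definition ell (z : nat) : int := (b z)%:Z - z%:Z + 3.

Definition zeta_spec (n z : nat) : Prop :=
  (0 < z)%N /\ ell z <= n%:Z < ell z.+1.

(* The default 0 is returned only for n < 3, see [zeta_unique]. *)
Definition zeta (n : nat) : nat := xget 0%N [set z | zeta_spec n z].

Definition logb (R : realType) (a x : R) : R := ln x / ln a.

Definition bigN (R : realType) (n : nat) : int :=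
  Num.floor (logb 2 (logb 5 (n%:R : R))) + 1.

(* For n >= 3 we have bigN R n >= 0, so `|bigN R n| is bigN R n as a natural
   number; it is 0 for n = 3, 4, where the sum is empty and the exponent
   bigN R n - 1 is the integer -1. *)
Definition r (R : realType) (n : nat) : R :=
  (\sum_(1 <= j < `|bigN R n|.+1) 1 / 2 ^+ (j - 1) * n%:R `^ (1 / 2 ^+ j))
  - (2 ^ (bigN R n - 1) - 1) / 2 ^ (bigN R n - 1).

Section ZetaWellDefined.
Local Open Scope nat_scope.

Lemma b_upto n k : n <= k <= b n -> weights n k.
Proof. by rewrite /b; case: ex_maxnP => m /asboolP H _; exact: H. Qed.

Lemma b_max n m : weights_upto n m -> m <= b n.
Proof. by rewrite /b; case: ex_maxnP => ? _; exact. Qed.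

Lemma b_le n : b n <= n ^ 2.
Proof. by apply: weights_upto_le; rewrite /b; case: ex_maxnP. Qed.

Lemma weights_extend (c : bool) n k :
  weights n k -> weights n.+1 (k + (c * n).+1).
Proof.
move=> [e <-].
pose f : rel 'I_n.+1 := fun x y =>
  match unlift ord0 x, unlift ord0 y with
  | Some a, Some b => connect e a b
  | None, None => true
  | None, Some _ => c
  | Some _, None => false
  end.
have fT : transitive f.
  move=> y x z; rewrite /f; case: (unlift _ x) => [?|];
    case: (unlift _ y) => [?|]; case: (unlift _ z) => [?|] //.
  exact: connect_trans.
have fR x : f x x by rewrite /f; case: unlift => // a; exact: connect0.
have fE x y : connect f x y = f x y.
  apply/idP/idP; last exact: connect1.
  case/connectP => p fp ->; elim: p x fp => //= z p IH x /andP[xz /IH].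
  exact: fT.
exists f; rewrite !weightE big_ord_recl addnC; congr (_ + _).
  apply: eq_bigr => x _; rewrite big_ord_recl fE /f liftK unlift_none add0n.
  by apply: eq_bigr => y _; rewrite fE /f !liftK.
rewrite big_ord_recl fE fR; congr (_.+1).
rewrite (eq_bigr (fun=> c : nat)) ?sum_nat_const ?card_ord 1?mulnC //.
by move=> y _; rewrite fE /f unlift_none liftK.
Qed.

Lemma b_succ n : 2 * n <= (b n).+1 -> b n + n.+1 <= b n.+1.
Proof.
move=> h; apply: b_max; apply/asboolP => k /andP[h1 h2].
case: (leqP k (b n).+1) => h3.
  have -> : k = k.-1 + (false * n).+1 by lia.
  by apply: weights_extend; apply: b_upto; lia.
have -> : k = k - n.+1 + (true * n).+1 by lia.
by apply: weights_extend; apply: b_upto; lia.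
Qed.

Lemma b1 : b 1 = 1.
Proof.
apply/eqP; rewrite eqn_leq (b_le 1); apply: b_max; apply/asboolP => k k1.
have [m /asboolP H] := ex_weights_upto 1.
have -> : k = 1 by lia.
exists (fun _ _ => false); apply/eqP; rewrite eqn_leq weight_ge.
by rewrite (weight_le (n := 1)).
Qed.

Lemma b_ge n : 0 < n -> 2 * n <= (b n).+1.
Proof.
elim: n => // -[_ _|n IH _]; first by rewrite b1.
by have := b_succ (IH isT); have := IH isT; lia.
Qed.

Lemma ell_succ n : 0 < n -> (ell n < ell n.+1)%R.
Proof. by move=> n0; have := b_succ (b_ge n0); rewrite /ell; lia. Qed.

Lemma zeta_unique n : 3 <= n -> unique (zeta_spec n) (zeta n).
Proof.
move=> n3.
have mono i j : 0 < i -> i <= j -> (ell i <= ell j)%R.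
  move=> i0; elim: j => [|j IH]; first by lia.
  rewrite leq_eqVlt => /orP[/eqP <-//|ij].
  by have := @ell_succ j; have := IH ij; lia.
have ex : exists z, (0 < z) && (ell z <= n%:Z)%R.
  by exists 1; rewrite /ell b1; lia.
have bd z : (0 < z) && (ell z <= n%:Z)%R -> z <= n.
  by case/andP=> z0; have := b_ge z0; rewrite /ell; lia.
have [z /andP[z0 zn] zmax] := ex_maxnP ex bd.
have zP : zeta_spec n z.
  split=> //; rewrite zn ltNge /=; apply/negP => h.
  by have := zmax z.+1 h; rewrite ltnn.
have xP : zeta_spec n (zeta n).
  exact: (@xgetPex _ 0 [set z | zeta_spec n z] (ex_intro _ z zP)).
split=> // y [y0 /andP[yn ny]]; have [x0 /andP[xn nx]] := xP.
have := mono (zeta n).+1 y; have := mono y.+1 (zeta n); lia.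
Qed.

End ZetaWellDefined.

(* Main.v *)
Require Import Defs.
From mathcomp Require Import all_boot all_order all_algebra.
From mathcomp Require Import all_classical all_reals all_analysis.
From mathcomp Require Import zify ring lra.

(** For z = zeta n and n <> 8 one has b n = n (n - z) + b z: joining n - k
    strongly connected vertices below a digraph of weight w on k vertices gives
    the weight n (n - k) + w, and the intervals obtained for k >= z overlap;
    conversely n (n - z) + b z + 1 is not a weight, by looking at a largest
    strongly connected component.  Hence, with y = zeta z,
      ell z = z^2 - z (y + 1) + ell y + y   and   ell y <= z < ell (y + 1),
    so that sqrt (ell z) is about z - y / 2.  On the other side r n is the value
    s_N(n), where s_0 = 1 and s_(k+1)(x) = sqrt x + (s_k(sqrt x) - 1) / 2.
    Both recursions halve the previous error, so z - s_k(ell z) stays between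
    -0.98 and 1.78 for large k, by induction from z to zeta z; replacing s_k by
    s_N costs at most 1.61 / 2^N, which is affordable because the error is
    smaller for small z. *)

Import Order.TTheory GRing.Theory Num.Theory.

Local Open Scope ring_scope.

(** * Weights and lower bounds on [b] *)

Section Weights.
Local Open Scope nat_scope.

(** Paths may leave [A]: [f] is reachability in all of [e], a preorder and hence its own closure. *)
Lemma weights_induced n (e : rel 'I_n) (A : {set 'I_n}) :
  weights #|A| (\sum_(x in A) \sum_(y in A) connect e x y).
Proof.
pose f : rel 'I_#|A| := fun i j => connect e (enum_val i) (enum_val j).
have fE i j : connect f i j = f i j.
  apply/idP/idP; last exact: connect1.
  case/connectP => p fp ->; elim: p i fp => [|k p IH] i /=.
    by move=> _; exact: connect0.
  by case/andP => ik /IH; exact: connect_trans.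
exists f; rewrite weightE [RHS]big_enum_val; apply: eq_bigr => i _.
by rewrite [RHS]big_enum_val; apply: eq_bigr => j _; rewrite fE.
Qed.

(** The [m] new vertices are reached from everywhere, which gives [(k + m) * m] pairs, and they
    reach no old vertex. *)
Lemma weights_join k m w : weights k w -> weights (k + m) ((k + m) * m + w).
Proof.
move=> [e <-].
pose f : rel 'I_(k + m) := fun x y =>
  match fintype.split x, fintype.split y with
  | _, inr _ => true
  | inl a, inl b => connect e a b
  | inr _, inl _ => false
  end.
have fE x y : connect f x y = f x y.
  apply/idP/idP; last exact: connect1.
  case/connectP => p fp ->; elim: p x fp => [|z p IH] x /=.
    by move=> _; rewrite /f; case: (fintype.split x) => // a; exact: connect0.
  case/andP => + /IH; rewrite /f.
  case: (fintype.split x) => ?; case: (fintype.split z) => ?;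
    case: (fintype.split _) => ? //.
  exact: connect_trans.
have sl i : fintype.split (lshift m i) = inl i := unsplitK (inl i).
have sr i : fintype.split (rshift k i) = inr i := unsplitK (inr i).
exists f; rewrite !weightE exchange_big big_split_ord /= addnC.
congr addn; last first.
  rewrite [RHS]exchange_big; apply: eq_bigr => j _; rewrite big_split_ord /=.
  rewrite [X in _ + X]big1 => [|i _]; last by rewrite fE /f sr sl.
  by rewrite addn0; apply: eq_bigr => i _; rewrite fE /f !sl.
rewrite (eq_bigr (fun=> k + m)) ?sum_nat_const ?card_ord 1?mulnC // => j _.
rewrite -[RHS]card_ord -sum1_card; apply: eq_bigr => i _.
by rewrite fE /f sr; case: (fintype.split i).
Qed.

Lemma weights_full n : weights n (n ^ 2).
Proof.
exists (fun _ _ => true); rewrite weightE (eq_bigr (fun=> n)).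
  by rewrite sum_nat_const card_ord.
move=> x _; rewrite -[RHS]card_ord -sum1_card; apply: eq_bigr => y _.
by rewrite connect1.
Qed.

Lemma weights_b_succ n : ~ weights n (b n).+1.
Proof.
move=> w; suff: (b n).+1 <= b n by rewrite ltnn.
apply: b_max; apply/asboolP => k /andP[nk]; rewrite leq_eqVlt => /orP[/eqP->//|].
by rewrite ltnS => kb; apply: b_upto; rewrite nk.
Qed.

Lemma ell_le i j : 0 < i -> i <= j -> (ell i <= ell j)%R.
Proof.
move=> i0; elim: j => [|j IH]; first by lia.
rewrite leq_eqVlt => /orP[/eqP<-//|ij].
by have := @ell_succ j; have := IH ij; lia.
Qed.

(* Downward induction on k: the weights n (n - k) + w with k <= w <= b k reach
   those obtained from k + 1 as soon as n < ell (k + 1). *)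
Lemma b_lower n k : k < n -> (n%:Z < ell k.+1)%R -> n * (n - k) + b k <= b n.
Proof.
have [m] := ubnP (n - k); elim: m k => // m IH k km kn nl.
have n0 : 0 < n by lia.
have bn := b_ge n0.
(* Every weight below [n * (n - k) + k], the least one obtained from [k] vertices, is already
   covered. *)
have prev : n * (n - k.+1) + (k + n) <= (b n).+1.
  case: (ltnP k.+1 n) => kn1; last by nia.
  have := IH k.+1; have := @ell_succ k.+1; rewrite /ell in nl *; lia.
apply: b_max; apply/asboolP => w /andP[nw wb].
case: (leqP w (b n)) => wbn; first by apply: b_upto; lia.
have E : n * (n - k) = n * (n - k.+1) + n by rewrite -mulnSr; congr muln; lia.
have -> : w = (k + (n - k)) * (n - k) + (w - n * (n - k)).
  by rewrite subnKC; lia.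
rewrite -[X in weights X](@subnKC k n); last by lia.
apply: weights_join; apply: b_upto; lia.
Qed.

Lemma b_0 : b 0 = 0.
Proof. by apply/eqP; rewrite -leqn0 (b_le 0). Qed.

Lemma b_2_ge : 4 <= b 2.
Proof. by have := @b_lower 2 0 isT; rewrite /ell b1 b_0; lia. Qed.

Lemma b_3_ge : 7 <= b 3.
Proof. by have := @b_lower 3 1 isT; have := b_2_ge; rewrite /ell b1; lia. Qed.

Lemma b_4_ge : 13 <= b 4.
Proof. by have := @b_lower 4 1 isT; have := b_2_ge; rewrite /ell b1; lia. Qed.

Lemma b_5_ge : 19 <= b 5.
Proof.
by have := @b_lower 5 2 isT; have := b_2_ge; have := b_3_ge; rewrite /ell; lia.
Qed.

Lemma b_6_ge : 28 <= b 6.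
Proof.
by have := @b_lower 6 2 isT; have := b_2_ge; have := b_3_ge; rewrite /ell; lia.
Qed.

Lemma b_7_ge : 35 <= b 7.
Proof.
by have := @b_lower 7 3 isT; have := b_3_ge; have := b_4_ge; rewrite /ell; lia.
Qed.

(** Joins over 3 and 2 vertices leave the gap 48, 49, which complete digraphs on 4 and 3 vertices
    happen to fill. *)
Lemma b_8_ge : 52 <= b 8.
Proof.
have b8 : 47 <= b 8.
  by have := @b_lower 8 3 isT; have := b_3_ge; have := b_4_ge; rewrite /ell; lia.
have j k w : k <= 8 -> weights k w -> weights 8 (8 * (8 - k) + w).
  by move=> k8 /(weights_join _ (8 - k) _); rewrite subnKC.
apply: b_max; apply/asboolP => w /andP[w8 w52].
case: (leqP w 47) => w47; first by apply: b_upto; lia.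
have [->|[->|w50]] : w = 48 \/ w = 49 \/ 50 <= w by lia.
- exact: (@j 4 16 isT (weights_full 4)).
- exact: (@j 3 9 isT (weights_full 3)).
have -> : w = 8 * (8 - 2) + (w - 48) by lia.
by apply: j => //; apply: b_upto; have := b_2_ge; lia.
Qed.

End Weights.

(** * Upper bounds on [b] *)

Section Upper.
Local Open Scope nat_scope.

Definition component (T : finType) (e : rel T) (v : T) : {set T} :=
  [set x | connect e v x && connect e x v]%SET.

(** Two vertices are connected in both directions only inside one component; otherwise the two
    orders together count at most 1. *)
Lemma weight_component_le n (e : rel 'I_n) s :
  (forall v, #|component _ e v| <= s) -> 2 * weight e <= n * (n + s).
Proof.
move=> cs; have -> : n * (n + s) = \sum_(i < n) (n + s).
  by rewrite sum_nat_const card_ord.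
rewrite weightE mul2n -addnn [X in X + _]exchange_big -big_split /=.
apply: leq_sum => x _; rewrite -big_split /=.
apply: (@leq_trans (n + #|component _ e x|)); last by rewrite leq_add2l.
rewrite -[X in X + #|_|]card_ord -!sum1_card [X in _ + X]big_mkcond -big_split /=.
apply: leq_sum => y _.
by rewrite inE; case: connect; case: connect.
Qed.

(** The vertices of a component are interchangeable, so only the size of [D] matters. The full
    component gives the weight of [e], a smaller [D] a weight on fewer vertices. *)
Lemma weight_component_split n (e : rel 'I_n) v (D : {set 'I_n}) :
  let R := ~: component _ e v in
  D \subset component _ e v ->
  \sum_(x in R :|: D) \sum_(y in R :|: D) connect e x y =
  \sum_(x in R) \sum_(y in R) connect e x y
  + #|D| * \sum_(x in R) (connect e v x + connect e x v) + #|D| ^ 2.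
Proof.
move=> R /fintype.subsetP DC.
have split_sum F : \sum_(x in R :|: D) F x = \sum_(x in D) F x + \sum_(x in R) F x.
  rewrite (big_setID (component _ e v)) /=; congr addn; apply: eq_bigl => x.
    rewrite !inE andb_orl andNb /=.
    by have := DC x; rewrite inE; case: (x \in D) => // ->.
  rewrite !inE; have := DC x; rewrite inE; case: (x \in D) => [->|] //.
  by rewrite orbF andbb.
rewrite split_sum.
have -> : \sum_(x in D) \sum_(y in R :|: D) connect e x y =
    #|D| * (#|D| + \sum_(y in R) connect e v y).
  rewrite -sum_nat_const; apply: eq_bigr => x /DC; rewrite inE => /andP[vx xv].
  rewrite split_sum; congr addn.
    rewrite -sum1_card; apply: eq_bigr => y /DC; rewrite inE => /andP[vy _].
    by rewrite (connect_trans xv vy).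
  apply: eq_bigr => y _; congr nat_of_bool; apply/idP/idP; exact: connect_trans.
have -> : \sum_(x in R) \sum_(y in R :|: D) connect e x y =
    #|D| * \sum_(x in R) connect e x v + \sum_(x in R) \sum_(y in R) connect e x y.
  rewrite big_distrr -big_split; apply: eq_bigr => x _ /=; rewrite split_sum.
  congr addn; rewrite -sum_nat_const; apply: eq_bigr => y /DC.
  rewrite inE => /andP[vy yv].
  congr nat_of_bool; apply/idP/idP => h; exact: connect_trans h _.
by rewrite big_split /=; lia.
Qed.

(** The last two hypotheses are [k ^ 2 <= n * (k - z) + b z] at [k = z + 1] and at [k = 2 * z - 1].
    By convexity it holds in between, so the largest component cannot omit that many vertices. *)
Lemma b_upper n z : 0 < z -> (ell z <= n%:Z)%R -> z.+1 ^ 2 <= n + b z ->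
  (2 * z).-1 ^ 2 <= n * z.-1 + b z -> b n <= n * (n - z) + b z.
Proof.
move=> z0 zn H1 H2; rewrite leqNgt; apply/negP => bn.
have bz := b_ge z0; rewrite /ell in zn.
have zn2 : z + 2 <= n by lia.
have [|e eT] := @b_upto n (n * (n - z) + b z).+1.
  by have := @leq_pmulr n (n - z); lia.
have v0 : 'I_n by exists 0; lia.
have [v _ vmax] := arg_maxnP (fun v => #|component _ e v|) (erefl (predT v0)).
have W2 := weight_component_le _ e _ (fun x => vmax x isT).
set C := component _ e v in vmax W2; set R := ~: C.
have Wsplit := weight_component_split _ e v.
rewrite /= -/C -/R in Wsplit.
set wR := (\sum_(x in R) \sum_(y in R) _) in Wsplit.
set u := (\sum_(x in R) (_ + _)) in Wsplit.
have WE : weight e = wR + #|C| * u + #|C| ^ 2.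
  rewrite -Wsplit // weightE /R finset.setUC finset.setUCr.
  by apply: eq_big => x; rewrite ?inE // => _; apply: eq_bigl => y; rewrite inE.
have Rn : #|C| + #|R| = n by rewrite cardsC card_ord.
have uR : u <= #|R|.
  rewrite -sum1_card; apply: leq_sum => x; rewrite !inE.
  by case: connect; case: connect.
have wRW : weights #|R| wR := weights_induced n e R.
have [wRl wRu] : #|R| <= wR /\ wR <= #|R| ^ 2.
  by case: wRW => f <-; rewrite weight_ge weight_le.
have s0 : 0 < #|C|.
  by apply/card_gt0P; exists v; rewrite inE connect0.
have key : forall j, j <= #|C| -> weights (#|R| + j) (wR + j * u + j ^ 2).
  move=> j /card_geqP[D [Du Dj DC]]; pose DS := [set:: D].
  have Dcard : #|DS| = j by rewrite cardsE (card_uniqP Du).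
  have DSC : DS \subset C by apply/fintype.subsetP => x; rewrite inE => /DC.
  have := weights_induced n e (R :|: DS); rewrite (Wsplit _ DSC) Dcard.
  rewrite -(eqP (_ : #|R :|: DS| == #|R| + j)) //.
  rewrite cardsU disjoint_setI0 ?cards0 ?subn0 ?Dcard //.
  by rewrite finset.disjoints_subset finset.setCS.
rewrite {}WE in eT W2; have nb := weights_b_succ z.
move: #|R| #|C| => k s in eT W2 Rn uR wRW wRl wRu s0 key *.
move: (b z) => c in zn H1 H2 bn bz eT W2 nb *.
clearbody wR u; clear -z0 zn H1 H2 zn2 eT W2 Rn uR wRW wRl wRu s0 key nb.
(* k is the number of vertices outside the largest component, u the number of
   those that are comparable to it.  When k + (k - u) = z, replacing the
   component by k - u of its vertices would give the weight b z + 1 on z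
   vertices; all other cases are excluded by size. *)
case: (ltngtP k z) => kz.
- have [j zE] : exists j, z = k + j by exists (z - k); lia.
  have [t kE] : exists t, k = u + t by exists (k - u); lia.
  have js : j <= s by lia.
  have [q sE] : exists q, s = j + q by exists (s - j); lia.
  have eT' : wR + s * j + k * j = s * t + c.+1.
    rewrite (_ : n - z = q) in eT; last lia.
    by move: eT; rewrite -Rn kE sE; clear; lia.
  have [tj|tj|tj] := ltngtP t j.
  + have [i jE] : exists i, j = t + i.+1 by exists (j - t.+1); lia.
    have : wR + s * i.+1 + k * j = c.+1 by move: eT'; rewrite jE; clear; lia.
    case: (posnP k) => k0.
      have t0 : t = 0 by lia.
      have : i <= s * i by rewrite leq_pmull.
      by rewrite k0 mul0n; lia.
    have : k + j <= k * j + 1 by move: k0; rewrite jE; clear; nia.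
    by lia.
  + have [i tE] : exists i, t = j + i.+1 by exists (t - j.+1); lia.
    have : wR + k * j = s * i.+1 + c.+1 by move: eT'; rewrite tE; clear; lia.
    have : k * z < z.+1 ^ 2 by rewrite zE; clear; lia.
    by rewrite zE; lia.
  + apply: nb; rewrite zE (_ : c.+1 = wR + j * u + j ^ 2); first exact: key.
    by move: eT'; rewrite tj kE tj; clear; lia.
- have m2 : k < 2 * z.
    rewrite ltnNge; apply/negP => k2.
    have : n * (n + s) <= n * (2 * (n - z)) by rewrite leq_mul2l; lia.
    by rewrite mulnCA; lia.
  have [i kE] : exists i, k = z + i.+1 by exists (k - z.+1); lia.
  have su : s * u <= s * k by rewrite leq_mul2l uR orbT.
  have up : c.+1 + n * i.+1 <= k ^ 2.
    rewrite (_ : n - z = s + i.+1) in eT; last lia.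
    by move: eT su wRu; rewrite -Rn; clear; lia.
  case: (leqP (k + z).+1 n) => nk.
    have : i * (k + z).+1 <= i * n by rewrite leq_mul2l nk orbT.
    by move: up H1; rewrite kE; clear; lia.
  have [d dE] : exists d, (2 * z).-1 = k + d by exists ((2 * z).-1 - k); lia.
  have : d * n <= d * ((2 * z).-1 + k) by rewrite leq_mul2l; lia.
  by move: up H2; rewrite dE (_ : z.-1 = i.+1 + d); [clear; lia | lia].
- have [uk|uk] := eqVneq u k.
    apply: nb; rewrite -kz; suff -> : c.+1 = wR by [].
    rewrite (_ : n - z = s) in eT; last lia.
    by move: eT; rewrite -Rn uk; clear; lia.
  have [t kE] : exists t, k = u + t.+1 by exists (k - u.+1); lia.
  rewrite (_ : n - z = s) in eT; last lia.
  have wE : wR = s * t.+1 + c.+1 by move: eT; rewrite -Rn kE; clear; lia.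
  have : s <= s * t.+1 by rewrite leq_pmulr.
  by move: wRu H1; rewrite -Rn kz wE; clear; lia.
Qed.
End Upper.

(** * Bounds on [b] through [zeta] *)

Section Ell.
Local Open Scope nat_scope.

Lemma zeta_exists n : 3 <= n ->
  exists y, [/\ 0 < y, y < n, (ell y <= n%:Z)%R & (n%:Z < ell y.+1)%R].
Proof.
move=> n3; have [[y0 /andP[yn ny]] _] := zeta_unique n3.
exists (zeta n); split=> //; have := b_ge y0; rewrite /ell in yn; lia.
Qed.

Lemma b_le_quadratic n : 3 <= n -> b n <= n * n.-1 + 1.
Proof. by move=> n3; have := @b_upper n 1 isT; rewrite subn1 /ell b1; lia. Qed.

Lemma b_8 : b 8 = 52.
Proof.
apply/eqP; rewrite eqn_leq b_8_ge andbT.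
have b2 : b 2 <= 4 := b_le 2.
by have := @b_upper 8 2 isT; have := b_2_ge; rewrite /ell; lia.
Qed.

Lemma b_quadratic_lower y : 5 * y ^ 2 + 8 * y <= 8 * b y + 24.
Proof.
elim/ltn_ind: y => y IH; case: (ltnP y 8) => y8.
  have [] := (b_0, b1); have := (b_2_ge, b_3_ge, b_4_ge, b_5_ge, b_6_ge, b_7_ge).
  case=> -[[[[]]]]; move: y y8 {IH} => [|[|[|[|[|[|[|[|//]]]]]]]] _; lia.
have [u [u0 uy ul yu]] := zeta_exists y (@leq_trans 8 3 y isT y8).
have IHu := IH u uy; have := b_lower y u uy yu; rewrite /ell in ul.
(* By [b_lower] at [u], the induction step reduces to [(y - u) * (3 * y - 5 * u - 8) >= 0]. *)
have key : 5 * u + 8 <= 3 * y.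
  case: (leqP u 3) => u3; first by lia.
  have : 4 * u <= u ^ 2 by rewrite expnS expn1 leq_mul2r u3 orbT.
  by lia.
have [d yE] : exists d, y = u + d.+1 by exists (y - u.+1); lia.
have : d.+1 * (2 * u + 8) <= d.+1 * (3 * d.+1) by rewrite leq_mul2l; lia.
rewrite (_ : y - u = d.+1); last lia.
by move: IHu; rewrite yE; clear; lia.
Qed.

(** For [y >= 7] the size hypotheses of [b_upper] follow from [ell y <= w] and the quadratic bound;
    smaller [y] use the computed values. At [y = 3] they need [w >= 9]. *)
Lemma b_upper_zeta w y : 0 < y -> (w != 7) && (w != 8) || (y != 3) ->
  (ell y <= w%:Z)%R -> b w <= w * (w - y) + b y.
Proof.
move=> y0 wy yw; apply: b_upper => //; rewrite /ell in yw.
  case: (ltnP y 7) => y7.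
    have [] := (b_0, b1); have := (b_2_ge, b_3_ge, b_4_ge, b_5_ge, b_6_ge).
    case=> -[[[]]]; move: y y7 y0 yw wy => [|[|[|[|[|[|[|//]]]]]]] _ //; lia.
  by have := b_quadratic_lower y; nia.
case: (ltnP y 7) => y7.
  have [] := (b_0, b1); have := (b_2_ge, b_3_ge, b_4_ge, b_5_ge, b_6_ge).
  case=> -[[[]]]; move: y y7 y0 yw wy => [|[|[|[|[|[|[|//]]]]]]] _ //; lia.
have := b_quadratic_lower y; have [d yE] : exists d, y = d.+1 by exists y.-1; lia.
have : b y + 3 <= w + y by lia.
by rewrite yE; nia.
Qed.
End Ell.

(** * Iterated square root sums *)

Fixpoint rsum {R : realType} (k : nat) (x : R) : R :=
  if k is k'.+1 then Num.sqrt x + (rsum k' (Num.sqrt x) - 1) / 2 else 1.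

Lemma sqrtr_lb (R : realType) (q x : R) : q ^+ 2 <= x -> q <= Num.sqrt x.
Proof.
move=> /ler_wsqrtr; rewrite sqrtr_sqr; apply: le_trans; exact: ler_norm.
Qed.

Lemma sqrtr_ub (R : realType) (q x : R) : 0 <= q -> x <= q ^+ 2 -> Num.sqrt x <= q.
Proof. by move=> q0 /ler_wsqrtr; rewrite sqrtr_sqr ger0_norm. Qed.

Lemma sqrtr_ge1 (R : realType) (x : R) : 1 <= x -> 1 <= Num.sqrt x.
Proof. by move=> x1; apply: sqrtr_lb; rewrite expr1n. Qed.

Lemma sqrtr_sub_le (R : realType) (d x w : R) :
  x <= w -> 0 <= x -> 0 < d <= Num.sqrt w + Num.sqrt x ->
  Num.sqrt w - Num.sqrt x <= (w - x) / d.
Proof.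
move=> xw x0 /andP[d0 dl]; rewrite ler_pdivlMr //.
have -> : w - x = (Num.sqrt w - Num.sqrt x) * (Num.sqrt w + Num.sqrt x).
  by rewrite -subr_sqr !sqr_sqrtr // (le_trans x0).
by apply: ler_wpM2l => //; rewrite subr_ge0 ler_wsqrtr.
Qed.

Lemma rsum_homo (R : realType) k (x w : R) : x <= w -> rsum k x <= rsum k w.
Proof.
elim: k x w => //= k IH x w /ler_wsqrtr xw.
by have := IH _ _ xw; lra.
Qed.

Lemma rsum_ge1 (R : realType) k (x : R) : 1 <= x -> 1 <= rsum k x.
Proof.
elim: k x => //= k IH x /sqrtr_ge1 x1; have := IH _ x1; lra.
Qed.

Lemma rsum_ub (R : realType) k (x : R) : 1 <= x ->
  rsum k x <= (3 * Num.sqrt x - 1) / 2.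
Proof.
elim: k x => [|k IH] x /sqrtr_ge1 x1 /=; first by lra.
have := IH _ x1; set t := Num.sqrt x in x1 *.
(* The induction step amounts to [2 * t - 3 * sqrt t + 1 >= 0], which factors in this way. *)
have : (2 * Num.sqrt t - 1) * (Num.sqrt t - 1) >= 0.
  by have := sqrtr_ge1 _ _ x1 => t1; apply: mulr_ge0; lra.
have : Num.sqrt t ^+ 2 = t by rewrite sqr_sqrtr; lra.
by rewrite expr2; lra.
Qed.

(** On arguments at least 1 the square root is 1/2-Lipschitz, and 2/3 solves
    [c = (1 + c / 2) / 2]. *)
Lemma rsum_lipschitz (R : realType) k (x w : R) : 1 <= x -> x <= w ->
  rsum k w - rsum k x <= 2 / 3 * (w - x).
Proof.
elim: k x w => [|k IH] x w x1 xw /=; first by lra.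
have sx := sqrtr_ge1 _ _ x1; have sw := ler_wsqrtr xw.
have := IH _ _ sx sw.
have := @sqrtr_sub_le R 2 x w xw; lra.
Qed.

(* [Num.sqrt] is the leading term: applied with d of the order of a fourth root,
   this leaves a relative error that tends to 0. *)
Lemma rsum_sub_le (R : realType) k (d x w : R) : 1 <= x -> x <= w ->
  0 < d <= Num.sqrt (Num.sqrt w) + Num.sqrt (Num.sqrt x) ->
  rsum k w - rsum k x <= (Num.sqrt w - Num.sqrt x) * (1 + 2 / 3 / d).
Proof.
case: k => [|k] x1 xw dle /=.
  rewrite subrr mulr_ge0 ?subr_ge0 ?ler_wsqrtr //.
  by case/andP: dle => d0 _; rewrite addr_ge0 // divr_ge0 //; lra.
have sx := sqrtr_ge1 _ _ x1; have sw := ler_wsqrtr xw.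
case: k => [|k] /=.
  have : 0 <= (Num.sqrt w - Num.sqrt x) * (2 / 3 / d).
    rewrite mulr_ge0 ?subr_ge0 // divr_ge0; lra.
  by lra.
have ssx := sqrtr_ge1 _ _ sx; have ssw := ler_wsqrtr sw.
have := @rsum_lipschitz R k _ _ ssx ssw.
have := @sqrtr_sub_le R d _ _ sw; rewrite dle => /(_ _ isT).
have -> : (Num.sqrt w - Num.sqrt x) * (1 + 2 / 3 / d) =
  Num.sqrt w - Num.sqrt x + 2 / 3 * ((Num.sqrt w - Num.sqrt x) / d) by ring.
by move=> /(_ ltac:(lra)); lra.
Qed.

Lemma rsum_tail (R : realType) k N (x : R) :
  rsum (N + k) x - rsum N x = (rsum k (iter N Num.sqrt x) - 1) / 2 ^+ N.
Proof.
elim: N x => [|N IH] x; first by rewrite add0n /= expr0 divr1.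
rewrite addSn iterSr [LHS]/= exprS invfM; have := IH (Num.sqrt x); lra.
Qed.

Lemma iter_sqrt_ge1 (R : realType) N (x : R) : 1 <= x -> 1 <= iter N Num.sqrt x.
Proof. by move=> x1; elim: N => //= N; exact: sqrtr_ge1. Qed.

Lemma iter_sqrt_le (R : realType) N (c x : R) : 0 <= c ->
  x <= c ^+ (2 ^ N) -> iter N Num.sqrt x <= c.
Proof.
move=> c0; elim: N x => [|N IH] x; first by rewrite expn0 expr1.
rewrite expnSr exprM iterSr => xc; apply: IH; apply: sqrtr_ub => //.
exact: exprn_ge0.
Qed.

(** After [N] square roots the argument is at most 5; one unfolding and [rsum_ub] then give
    [2.237 + (3 * 1.496 - 3) / 4 - 1 = 1.609]. *)
Lemma rsum_tail_le (R : realType) k N (x : R) : 1 <= x -> x <= 5 ^+ (2 ^ N) ->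
  rsum (N + k) x - rsum N x <= 161 / 100 / 2 ^+ N.
Proof.
move=> x1 x5; rewrite rsum_tail ler_pM2r; last by rewrite invr_gt0 exprn_gt0.
have := iter_sqrt_le R N 5 x (ler0n _ 5) x5; set t := iter _ _ _ => t5.
case: k => [|k] /=; first by lra.
have s5 : Num.sqrt t <= 2237 / 1000 by apply: sqrtr_ub; lra.
have := @rsum_ub R k (Num.sqrt t); rewrite sqrtr_ge1 ?iter_sqrt_ge1 // => /(_ isT).
have : Num.sqrt (Num.sqrt t) <= 1496 / 1000 by apply: sqrtr_ub; lra.
lra.
Qed.

(** [1 - 2 / 2 ^+ N] is the constant subtracted in [r], in a form that avoids the exponent
    [N - 1]. *)
Lemma rsum_powR (R : realType) N (x : R) : 0 <= x ->
  \sum_(1 <= j < N.+1) 1 / 2 ^+ (j - 1) * x `^ (1 / 2 ^+ j) - (1 - 2 / 2 ^+ N)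
  = rsum N x.
Proof.
elim: N x => [|N IH] x x0 /=; first by rewrite big_geq // expr0; lra.
rewrite big_ltn // big_add1 /= subnn expr0 divr1 mul1r expr1 div1r powR12_sqrt //.
rewrite -(IH _ (sqrtr_ge0 x)).
rewrite (eq_big_nat _ _ (F2 := fun j =>
  2^-1 * (1 / 2 ^+ (j - 1) * Num.sqrt x `^ (1 / 2 ^+ j)))); last first.
  move=> j /andP[j1 _]; rewrite -powR12_sqrt // -powRrM.
  rewrite (_ : (j.+1 - 1 = (j - 1).+1)%N); last by lia.
  by rewrite !exprS !div1r !invfM !mulrA.
rewrite -big_distrr /= exprS invfM.
move: (\sum_(_ <= _ < _) _) => s; lra.
Qed.

(** * The number of terms [bigN] and the identification of [r] *)

Lemma le_floor_logb (R : realType) (i n : nat) : (1 < n)%N ->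
  (i%:Z <= Num.floor (logb 2 (logb 5 (n%:R : R)))) = (5 ^ (2 ^ i) <= n)%N.
Proof.
move=> n1; have lg m : (1 < m)%N -> 0 < ln (m%:R : R).
  by move=> m1; rewrite ln_gt0 // ltr1n.
have l2 := lg 2 isT; have l5 := lg 5 isT; have ln := lg n n1.
rewrite floor_ge_int /logb ler_pdivlMr // mulrC -pmulrn mulr_natr -lnXn ?ltr0n //.
rewrite ler_ln ?posrE ?exprn_gt0 ?divr_gt0 // ler_pdivlMr //.
rewrite mulrC -natrX mulr_natr -lnXn ?ltr0n //.
by rewrite ler_ln ?posrE ?exprn_gt0 ?ltr0n -?natrX ?ler_nat //; lia.
Qed.

(** Clearing the logarithms in [log_2 (log_5 n) >= -1] leaves [5 <= n ^ 2]. *)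
Lemma bigN_ge0 (R : realType) (n : nat) : (3 <= n)%N -> 0 <= bigN R n.
Proof.
move=> n3; have lg m : (1 < m)%N -> 0 < ln (m%:R : R).
  by move=> m1; rewrite ln_gt0 // ltr1n.
have l2 := lg 2 isT; have l5 := lg 5 isT; have ln := lg n (ltnW n3).
rewrite /bigN -lerBlDr sub0r floor_ge_int /logb ler_pdivlMr //.
rewrite mulrN1z mulN1r -lnV ?posrE // ler_ln ?posrE ?invr_gt0 ?divr_gt0 //.
rewrite ler_pdivlMr // mulrC ler_pdivrMr // mulr_natr -lnXn ?ltr0n //; last lia.
by rewrite ler_ln ?posrE -?natrX ?ltr0n ?ler_nat //; nia.
Qed.

(** Thus [bigN] is the least [i] with [n < 5 ^ (2 ^ i)], the form used in the final estimate. *)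
Lemma absz_bigN_gt (R : realType) (i n : nat) : (3 <= n)%N ->
  (i < `|bigN R n|)%N = (5 ^ (2 ^ i) <= n)%N.
Proof.
move=> n3; rewrite -(@le_floor_logb R); last exact: ltnW.
by rewrite -ltz_nat gez0_abs ?bigN_ge0 // /bigN ltzD1.
Qed.

Lemma r_rsum (R : realType) (n : nat) : (3 <= n)%N ->
  r R n = rsum `|bigN R n| n%:R.
Proof.
move=> n3; rewrite -rsum_powR // /r; congr (_ - _).
rewrite -[in LHS](gez0_abs (bigN_ge0 R n n3)) expfzDr // -exprnP exprN1.
have : (2 : R) ^+ `|bigN R n| != 0 by rewrite expf_neq0.
by move: (2 ^+ _) => t t0; field.
Qed.

(** * The error terms *)

Lemma ellR (R : realType) z : (ell z)%:~R = (b z)%:R - z%:R + 3 :> R.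
Proof. by rewrite /ell intrD intrB -!pmulrn. Qed.

(* For w = 7, 8 one has zeta w = 3, for which [b_upper] does not apply (and
   b 8 = 52 > 8 (8 - 3) + b 3), so y = 2 is taken instead. *)
Lemma b_upper_exists w : (3 <= w)%N ->
  exists y, [/\ (0 < y)%N, (y + 2 <= w)%N, (b y + 3 <= w + y)%N,
    (b w <= w * (w - y) + b y)%N & (ell w <= (ell y.+1) ^+ 2)%R].
Proof.
move=> w3.
have [w78|w78] := boolP ((w == 7%N) || (w == 8%N)).
  have b2 : (b 2 <= 4)%N := b_le 2.
  have up : (b w <= w * (w - 2) + b 2)%N.
    by apply: b_upper_zeta; rewrite ?orbT // /ell; lia.
  exists 2%N; split=> //; try lia.
  have := b_3_ge; rewrite /ell.
  by case/orP: w78 => /eqP wE; rewrite wE in up *; nia.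
have [y [y0 yw yl wl]] := zeta_exists w w3.
have up : (b w <= w * (w - y) + b y)%N.
  by apply: b_upper_zeta; rewrite // -negb_or w78.
have yb := b_ge y0; rewrite /ell in yl.
exists y; split=> //; try lia.
apply: (@le_trans _ _ (w%:Z ^+ 2)); last by rewrite ler_pXn2r ?nnegrE //; lia.
rewrite /ell; have [d wE] : exists d, w = (y + d)%N by exists (w - y)%N; lia.
by move: up yl; rewrite wE addKn; clear; nia.
Qed.

(** The error 0.98 reproduces itself: the square root exceeds [w - y / 2] by at most 0.49, and half
    the error at [y + 1] adds 0.49. *)
Lemma rsum_ell_le (R : realType) k w : (2 <= w)%N ->
  rsum k ((ell w)%:~R : R) <= w%:R + 98 / 100.
Proof.
elim/ltn_ind: w k => w IH [|k] w2 /=.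
  have : 2 <= w%:R :> R by rewrite ler_nat.
  lra.
case: (ltnP w 3) => w3.
  have -> : w = 2%N by lia.
  have l5 : (ell 2)%:~R <= 5 :> R.
    by have := b_le 2; rewrite ellR -(ler_nat R) => b2; lra.
  have l1 : 1 <= (ell 2)%:~R :> R.
    by have := b_2_ge; rewrite ellR -(ler_nat R) => b2; lra.
  have := rsum_ub R k.+1 _ l1; rewrite /=.
  have : Num.sqrt ((ell 2)%:~R) <= 224 / 100 :> R by apply: sqrtr_ub; lra.
  lra.
have [y [y0 yw by_ bw lw]] := b_upper_exists w w3.
have := IH y.+1 ltac:(lia) k ltac:(lia); rewrite -natr1.
have xy : Num.sqrt ((ell w)%:~R) <= (ell y.+1)%:~R :> R.
  apply: sqrtr_ub; first by rewrite ler0z /ell; have := b_ge (ltn0Sn y); lia.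
  by rewrite -rmorphXn ler_int.
have := rsum_homo R k _ _ xy.
suff : Num.sqrt ((ell w)%:~R) <= w%:R - y%:R / 2 + 49 / 100 :> R by lra.
have yl1 : 1 <= y%:R :> R by rewrite ler1n.
have yw' : y%:R + 2 <= w%:R :> R by rewrite -natrD ler_nat.
apply: sqrtr_ub; first by lra.
rewrite ellR; move: by_ bw.
rewrite -!(ler_nat R) !natrD natrM (@natrB _ w y); last lia.
move: (b w)%:R (b y)%:R w%:R y%:R yl1 yw' => B A W Y Y1 YW h1 h2.
(* Once [W] is bounded below by [Y + 2], the two sides differ by this square plus a positive
   constant. *)
have : 0 <= (Y / 2 - 51 / 100) ^+ 2 by exact: sqr_ge0.
nra.
Qed.

Lemma ell_lower (R : realType) z y : (y < z)%N -> (z%:Z < ell y.+1) ->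
  (z%:R ^+ 2 - z%:R * (y%:R + 1) + (b y)%:R + 3 <= (ell z)%:~R :> R).
Proof.
move=> yz zl; have := b_lower z y yz zl; rewrite ellR -(ler_nat R).
rewrite natrD natrM (@natrB _ z y); last exact: ltnW.
lra.
Qed.

Lemma rsum_lb2 (R : realType) k (c q x : R) : 1 <= c ->
  c ^+ 2 <= x -> q ^+ 2 <= c -> c + (q - 1) / 2 <= rsum k.+2 x.
Proof.
move=> c1 /sqrtr_lb cx qc /=.
have /sqrtr_lb qx := le_trans qc cx.
have := rsum_ge1 R k _ (sqrtr_ge1 _ _ (le_trans c1 cx)); lra.
Qed.

Lemma rsum_ell_ge_small (R : realType) k y z (c q : R) :
  (y < z)%N -> z%:Z < ell y.+1 -> 1 <= z%:R - c -> q ^+ 2 <= z%:R - c ->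
  (z%:R - c) ^+ 2 <= z%:R ^+ 2 - z%:R * (y%:R + 1) + (b y)%:R + 3 ->
  z%:R - (c - (q - 1) / 2) <= rsum k.+2 ((ell z)%:~R : R).
Proof.
move=> yz zl c1 qc cX; have := ell_lower R z y yz zl => /(le_trans cX) cl.
by have := rsum_lb2 R k _ _ _ c1 cl qc; lra.
Qed.

(* With x the square root of the argument on the right, z - x is at most
   y / 2 + 1 / 5, and when x < a the deficit of [rsum k x] costs at most another
   0.19; 178 / 100 is chosen so that half of it absorbs 1 / 2 + 1 / 5 + 0.19. *)
Lemma rsum_ell_ge_step (R : realType) k (y z a : R) :
  8 <= y -> 5 / 8 * y ^+ 2 <= a -> a <= z -> z <= 2 * a ->
  y - 178 / 100 <= rsum k a ->
  z - 178 / 100 <= rsum k.+1 (z ^+ 2 - z * (y + 1) + a + y).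
Proof.
move=> y8 ya az za IH /=; set X := _ + y; set x := Num.sqrt X.
have yy : 8 * y <= y ^+ 2 by rewrite expr2 ler_wpM2r //; lra.
have x0 : z - y / 2 - 38 / 100 <= x.
  by apply: sqrtr_lb; rewrite /X; nra.
have [ax|xa] := lerP a x.
  by have := rsum_homo R k _ _ ax; lra.
have yU : y != 0 by lra.
(* The gain [e] in the bound on [x] pays for the term of order [1 / y] in the bound on
   [(a - x) / (1.535 * y)]. *)
pose e := 15 / 100 / y.
have ey : e * y = 15 / 100 by rewrite /e divfK.
have e0 : 0 <= e by rewrite divr_ge0; lra.
have e1 : e <= 2 / 100 by rewrite ler_pdivrMr; lra.
have x1 : z - y / 2 - 2 / 10 + e <= x.
  apply: sqrtr_lb; rewrite /X.
  have : 5 / 8 * y ^+ 2 * (4 / 10 - 2 * e) <= z * (4 / 10 - 2 * e).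
    by rewrite ler_wpM2r //; lra.
  have -> : 5 / 8 * y ^+ 2 * (4 / 10 - 2 * e) =
    y ^+ 2 / 4 - 10 / 8 * y * (e * y) by field.
  have : (2 / 10 - e) ^+ 2 <= 4 / 100 by nra.
  have -> : (z - y / 2 - 2 / 10 + e) ^+ 2 =
    z ^+ 2 - z * y - z * (4 / 10 - 2 * e) + y ^+ 2 / 4 + 2 / 10 * y - e * y
    + (2 / 10 - e) ^+ 2 by field.
  by rewrite ey; lra.
(* The bounds follow from [a >= 5 / 8 * y ^+ 2] and [y >= 8]; their sums 0.79 + 0.745 and 2.50 +
   2.44 are the divisors 1.535 and 4.94 below. *)
have sa : 79 / 100 * y <= Num.sqrt a by apply: sqrtr_lb; rewrite exprMn; lra.
have sx : 745 / 1000 * y <= Num.sqrt x by apply: sqrtr_lb; rewrite exprMn; lra.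
have ssa : 250 / 100 <= Num.sqrt (Num.sqrt a) by apply: sqrtr_lb; lra.
have ssx : 244 / 100 <= Num.sqrt (Num.sqrt x) by apply: sqrtr_lb; lra.
have x2 : 1 <= x by lra.
have := @rsum_sub_le R k (494 / 100) x a x2 (ltW xa).
move=> /(_ ltac:(lra)).
have := @sqrtr_sub_le R (1535 / 1000 * y) x a (ltW xa).
move=> /(_ ltac:(lra) ltac:(lra)).
have : (a - x) / (1535 / 1000 * y) <= 3258 / 10000 + 869 / 1000 * e.
  rewrite ler_pdivrMr; last by lra.
  have -> : (3258 / 10000 + 869 / 1000 * e) * (1535 / 1000 * y) =
    3258 / 10000 * (1535 / 1000) * y + 869 / 1000 * (1535 / 1000) * (e * y) by ring.
  by rewrite ey; lra.
lra.
Qed.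

(** The thresholds follow the number [N] of terms of [r]: [N = 0, 1, 2] force [z <= 1, 5, 30]. Slack
    plus [1.61 / 2 ^ N] is then at most 1.61, 1.905, 1.9025, and 1.98125 for [N >= 3]. *)
Definition ell_slack (R : realType) (z : nat) : R :=
  if (z <= 1)%N then 0 else if (z <= 5)%N then 11 / 10
  else if (z <= 30)%N then 3 / 2 else 178 / 100.

Lemma rsum_ell_ge_table (R : realType) k z : (0 < z <= 46)%N ->
  z%:R - ell_slack R z <= rsum k.+2 ((ell z)%:~R : R).
Proof.
move=> z46.
(* On [l <= z <= u] the first two square roots are at least [z - c] and [q]. Each [u] below is one
   less than the known lower bound on [ell y.+1]. *)
have go y b0 l u (c q s : R) : (y < l <= z)%N -> (z <= u)%N -> (b0 <= b y)%N ->
    u%:Z < ell y.+1 -> c - (q - 1) / 2 <= s -> 1 <= l%:R - c ->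
    q ^+ 2 <= l%:R - c ->
    (forall x, l%:R <= x -> x <= u%:R ->
      (x - c) ^+ 2 <= x ^+ 2 - x * (y%:R + 1) + b0%:R + 3) ->
    z%:R - s <= rsum k.+2 ((ell z)%:~R : R).
  move=> /andP[yl lz] zu b0y uy cs c1 qc cX.
  have lz' : l%:R <= z%:R :> R by rewrite ler_nat.
  have zu' : z%:R <= u%:R :> R by rewrite ler_nat.
  have by_ : b0%:R <= (b y)%:R :> R by rewrite ler_nat.
  apply: (@le_trans _ _ (z%:R - (c - (q - 1) / 2))); first by lra.
  apply: (@rsum_ell_ge_small R k y); first exact: leq_trans yl lz.
  - by apply: le_lt_trans uy; rewrite lez_nat.
  - by lra.
  - by lra.
  - by have := cX _ lz' zu'; lra.
have L2 : 5 <= ell 2 by rewrite /ell; have := b_2_ge; lia.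
have L3 : 7 <= ell 3 by rewrite /ell; have := b_3_ge; lia.
have L4 : 12 <= ell 4 by rewrite /ell; have := b_4_ge; lia.
have L5 : 17 <= ell 5 by rewrite /ell; have := b_5_ge; lia.
have L6 : 25 <= ell 6 by rewrite /ell; have := b_6_ge; lia.
have L7 : 31 <= ell 7 by rewrite /ell; have := b_7_ge; lia.
have L8 : 47 <= ell 8 by rewrite /ell; have := b_8_ge; lia.
rewrite /ell_slack; case: (leqP z 1) => z1.
  by apply: (go 0%N 0%N 1%N 1%N 0 1);
    rewrite ?b_0 /ell ?b1; try lia; intros; lra.
case: (leqP z 5) => z5.
  case: (leqP z 4) => z4.
    by apply: (go 1%N 1%N 2%N 4%N 1 1); rewrite ?b1; try lia; intros; nra.
  by apply: (go 2%N 4%N 5%N 6%N (3 / 2) (187 / 100));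
    rewrite ?b_2_ge; try lia; intros; nra.
case: (leqP z 30) => z30.
  case: (leqP z 6) => z6.
    by apply: (go 2%N 4%N 5%N 6%N (3 / 2) (187 / 100));
      rewrite ?b_2_ge; try lia; intros; nra.
  case: (leqP z 11) => z11.
    by apply: (go 3%N 7%N 7%N 11%N 2 (22 / 10));
      rewrite ?b_3_ge; try lia; intros; nra.
  case: (leqP z 16) => z16.
    by apply: (go 4%N 13%N 12%N 16%N (5 / 2) 3);
      rewrite ?b_4_ge; try lia; intros; nra.
  case: (leqP z 24) => z24.
    by apply: (go 5%N 19%N 17%N 24%N (28 / 10) (37 / 10));
      rewrite ?b_5_ge; try lia; intros; nra.
  by apply: (go 6%N 28%N 25%N 30%N (32 / 10) (46 / 10));
    rewrite ?b_6_ge; try lia; intros; nra.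
by apply: (go 7%N 35%N 31%N 46%N (38 / 10) (52 / 10));
  rewrite ?b_7_ge; try lia; intros; nra.
Qed.

Lemma ell_slack_le (R : realType) z : ell_slack R z <= 178 / 100.
Proof. by rewrite /ell_slack; do !case: ifP => _; lra. Qed.

(** Each passage from [z] to a smaller [y] uses one unfolding of [rsum], and the table uses two, so
    [z + 2] unfoldings suffice. *)
Lemma rsum_ell_ge (R : realType) k z : (0 < z)%N -> (z + 2 <= k)%N ->
  z%:R - ell_slack R z <= rsum k ((ell z)%:~R : R).
Proof.
elim/ltn_ind: z k => z IH [|k] z0 zk; first by lia.
case: (leqP z 46) => z46.
  by case: k zk => [|k] zk; [lia | apply: rsum_ell_ge_table; lia].
have [y [y0 yz yl zl]] := zeta_exists z ltac:(lia).
(* The table ends at 46 because [ell 8 = 47]. *)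
have y8 : (8 <= y)%N.
  rewrite leqNgt; apply/negP => y8.
  have := @ell_le y.+1 8 isT y8; rewrite {2}/ell b_8; lia.
have := IH y yz k y0 ltac:(lia); have := ell_slack_le R y => sy IHy.
have z0' : ell_slack R z = 178 / 100.
  by rewrite /ell_slack; (do !case: ifP => [?|_]) => //; lia.
rewrite z0'.
have yR : 8 <= y%:R :> R by rewrite ler_nat.
have bq := b_quadratic_lower y; have bu := b_le_quadratic y.+1 ltac:(lia).
have bR : 5 * y%:R ^+ 2 + 8 * y%:R <= 8 * (b y)%:R + 24 :> R.
  by rewrite -natrX -!natrM -!natrD ler_nat.
have yy : 8 * y%:R <= y%:R ^+ 2 :> R by rewrite expr2 ler_wpM2r //; lra.
have lR : (b y)%:R + 3 <= z%:R + y%:R :> R.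
  by rewrite -!natrD ler_nat; rewrite /ell in yl; lia.
have uR : z%:R <= y%:R ^+ 2 + 2 :> R.
  by rewrite -natrX -natrD ler_nat; move: zl bu; rewrite /ell /=; lia.
have := rsum_ell_ge_step R k y%:R z%:R (ell y)%:~R yR.
rewrite ellR => /(_ ltac:(lra) ltac:(lra) ltac:(lra)).
rewrite -ellR => /(_ ltac:(lra)) step; apply: le_trans step _.
apply: rsum_homo; have := ell_lower R z y yz zl; rewrite (ellR R y); lra.
Qed.

Theorem theorem4p6 (R : realType) (n : nat) (hn : (3 <= n)%N) :
  `| (zeta n)%:R - r R n | < 1985 / 1000.
Proof.
have [[z0 /andP[zn nz]] _] := zeta_unique hn.
move: (zeta n) z0 zn nz => z z0 zn nz.
have lz : (ell z)%:~R <= n%:R :> R by rewrite pmulrn ler_int.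
have uz : n%:R <= (ell z.+1)%:~R :> R by rewrite pmulrn ler_int ltW.
have n1 : 1 <= n%:R :> R by rewrite ler1n; lia.
rewrite (r_rsum R n hn); have Ngt i := absz_bigN_gt R i n hn.
move: `|bigN R n|%N Ngt => N Ngt.
have nN : (n%:R : R) <= 5 ^+ (2 ^ N).
  by rewrite -natrX ler_nat ltnW // ltnNge -Ngt ltnn.
(* The lower bound on [r] needs [z + 2] extra terms, whose removal costs [1.61 / 2 ^ N]; the upper
   bound holds for any number of terms and gives [z + 1.98]. *)
have := rsum_tail_le R (z + 2) N _ n1 nN.
have := rsum_homo R (N + (z + 2)) _ _ lz.
have := rsum_ell_ge R (N + (z + 2)) z z0 (leq_addl _ _).
have := rsum_homo R N _ _ uz; have := rsum_ell_le R N z.+1 z0; rewrite -natr1.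
suff : ell_slack R z + 161 / 100 / 2 ^+ N < 1985 / 1000.
  by move=> *; rewrite ltr_norml; apply/andP; split; lra.
have zlt i m c : (N <= i)%N -> (0 < m)%N -> (5 ^ 2 ^ i = c)%N ->
    c%:Z <= ell m -> (z < m)%N.
  move=> Ni m0 <- lm; rewrite ltnNge; apply/negP => mz.
  have := Ngt i; rewrite ltnNge Ni /= => /esym /negbT /negP; apply.
  by rewrite -lez_nat (le_trans lm) // (le_trans _ zn) // ell_le.
have : ell_slack R z <= 178 / 100 := ell_slack_le R z.
case: N zlt {Ngt nN} => [|[|[|N]]] zlt.
- have -> : (z = 1)%N.
    have := zlt 0%N 2%N 5%N isT isT erefl.
    by have := b_2_ge; rewrite /ell; lia.
  by rewrite /ell_slack expr0 /=; lra.
- have z5 : (z <= 5)%N.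
    have := zlt 1%N 6%N 25%N isT isT erefl.
    by have := b_6_ge; rewrite /ell; lia.
  by rewrite /ell_slack z5 expr1; case: ifP => _; lra.
- have z30 : (z <= 30)%N.
    (* [b_lower] at 6 gives [ell 29 >= 29 * 23 + 28 - 29 + 3 = 669], which exceeds 625. *)
    have := zlt 2%N 29%N 625%N isT isT erefl; have := @b_lower 29 6 isT.
    by have := b_6_ge; have := b_7_ge; rewrite /ell; lia.
  by rewrite /ell_slack z30; do !case: ifP => _; lra.
- have : 161 / 100 / 2 ^+ N.+3 <= 161 / 100 / 8 :> R; last by lra.
  rewrite ler_pM2l; last by lra.
  rewrite lef_pV2 ?posrE ?exprn_gt0 // (_ : 8 = 2 ^+ 3); last by lra.
  by rewrite ler_weXn2l // ler1n.
Qed.
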